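(* Let $(x_k)_{k\ge 0}$ and $(y_k)_{k\ge 0}$ be the sequences generated by the VAST algorithm (defined in the context) applied to the problem $\min_{x\in\mathcal H}F(x)=f(x)+g(Kx)$. Assume that for every $k\ge 1$ $$\mu_k-\mu_{k+1}-\frac{\mu_{k+1}}{t_{k+1}}\le 0 \qquad\text{and}\qquad \left(1-\frac{1}{t_{k+1}}\right)\gamma_{k+1}t_{k+1}^2=\gamma_k t_k^2 .$$ Then for every optimal solution $x^*$ of the problem (i.e. every minimizer of $F$ over $\mathcal H$) and every $N\ge 1$, $$F(x_N)-F(x^* )\le \frac{\lVert x_0-x^*\rVert^2}{2\gamma_N t_N^2}+\mu_N\frac{L_g^2}{2}.$$
   Context: $\mathcal H,\mathcal G$ are real Hilbert spaces; $f:\mathcal H\to\overline{\mathbb R}$ (extended reals) is proper, convex and lower semicontinuous; $g:\mathcal G\to\mathbb R$ is convex and $L_g$-Lipschitz continuous with $L_g>0$; $K:\mathcal H\to\mathcal G$ is a nonzero continuous linear operator with adjoint $K^*$. Put $F:=f+g\circ K$. $g^*$ denotes the convex (Fenchel) conjugate of $g$, and $\operatorname{prox}_{h}(x)$ denotes the unique minimizer of $u\mapsto h(u)+\frac12\lVert u-x\rVert^2$ for $h$ proper, convex, lower semicontinuous. VAST algorithm: let $y_0=x_0\in\mathcal H$, let $(\mu_k)_{k\ge1}$ be a sequence in $(0,+\infty)$, and let $(t_k)_{k\ge1}$ be real numbers with $t_1=1$ and $t_k\ge 1$ for all $k\ge2$. For every $k\ge1$ set $L_k=\frac{\lVert K\rVert^2}{\mu_k}$,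 $\gamma_k=\frac1{L_k}$, $$x_k=\operatorname{prox}_{\gamma_k f}\!\left(y_{k-1}-\gamma_k K^*\operatorname{prox}_{\frac1{\mu_k}g^*}\!\left(\tfrac{Ky_{k-1}}{\mu_k}\right)\right),\qquad y_k=x_k+\frac{t_k-1}{t_{k+1}}(x_k-x_{k-1}).$$ *)

(* Defs.v *)
From HB Require Import structures.
From mathcomp Require Import all_boot all_order all_algebra.
From mathcomp Require Import interval_inference.
From mathcomp Require Import all_classical all_reals ereal topology normedtype.
From mathcomp Require Import convex.

Set Implicit Arguments.
Unset Strict Implicit.
Unset Printing Implicit Defensive.

Import Order.TTheory GRing.Theory Num.Theory.
Import numFieldNormedType.Exports.

Local Open Scope classical_set_scope.
Local Open Scope ring_scope.

(* A real Hilbert space is a Banach space whose norm comes from an inner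
   product. *)
HB.mixin Record CompleteNormedModule_isHilbert (R : realType) H
    of CompleteNormedModule R H := {
  inner : {dot H for idfun} ;
  inner_norm : forall x : H, inner x x = `|x| ^+ 2
}.

#[short(type="hilbertType")]
HB.structure Definition Hilbert (R : realType) :=
  {H of CompleteNormedModule_isHilbert R H & CompleteNormedModule R H}.

Section Definitions.
Context {R : realType}.

Definition is_minimizer (T : Type) (h : T -> \bar R) (p : T) : Prop :=
  forall u, (h p <= h u)%E.

Section OneSpace.
Context {H : hilbertType R}.
Implicit Types (h : H -> \bar R) (x y p : H).

Definition proper_fun h : Prop :=
  (forall x, (-oo < h x)%E) /\ (exists x, (h x < +oo)%E).

(* [convex_function] of the library only covers real-valued functions. This
   is its extended-real analogue; it is used for functions that do not take
   the value -oo, so that no sum is of the form +oo - oo. The endpoints t = 0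
   and t = 1 are harmless because 0 * +oo = 0. *)
Definition convex_efun h : Prop :=
  forall (t : R) x y, 0 <= t <= 1 ->
    (h (t *: x + (1 - t) *: y)%R <= t%:E * h x + (1 - t)%:E * h y)%E.

Definition fenchel_conjugate h : H -> \bar R :=
  fun y => ereal_sup [set ((inner x y)%:E - h x)%E | x in [set: H]].

(* The default value 0 is only reached when there is no minimizer; for h
   proper, convex and lower semicontinuous the minimizer exists and is
   unique. *)
Definition prox h x : H :=
  xget 0 [set p : H |
    is_minimizer (fun u : H => h u + (2^-1 * `|u - x| ^+ 2)%:E)%E p].

End OneSpace.

Section TwoSpaces.
Context {H G : hilbertType R}.
Implicit Types (K : H -> G) (f : H -> \bar R) (g : G -> R).
Implicit Types (mu t : nat -> R) (x y : nat -> H).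

Definition operator_norm K : R :=
  sup [set `|K u| | u in [set u : H | `|u| <= 1]].

(* For K linear and continuous exactly one z satisfies the defining identity,
   so the default value 0 is never reached. *)
Definition adjoint K : G -> H :=
  fun v => xget 0 [set z : H | forall u : H, inner (K u) v = inner u z].

Definition objective f g K : H -> \bar R := fun u => (f u + (g (K u))%:E)%E.

Definition vast_L K mu (k : nat) : R := operator_norm K ^+ 2 / mu k.

Definition vast_gamma K mu (k : nat) : R := 1 / vast_L K mu k.

(* x and y are indexed from 0, the parameters mu and t from 1: mu 0 and t 0
   are never used. *)
Definition vast_sequences f g K mu t x y : Prop :=
  y 0%N = x 0%N /\
  forall k : nat, (1 <= k)%N ->
    let gamma := vast_gamma K mu k in
    let gstar := fenchel_conjugate (fun v => (g v)%:E) in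
    x k = prox (fun u => (gamma%:E * f u)%E)
            (y k.-1 - gamma *:
               adjoint K (prox (fun v => ((1 / mu k)%:E * gstar v)%E)
                               ((mu k)^-1 *: K (y k.-1)))) /\
    y k = x k + ((t k - 1) / t k.+1) *: (x k - x k.-1).

End TwoSpaces.
End Definitions.

(* Main.v *)
(* With [E k] the value at [x k] of the objective whose nonsmooth part [g] is
   replaced by its Moreau envelope of parameter [mu k], the quantity
     [2 * gamma k * t k ^ 2 * (E k - F xs)
      + |t k x k - (t k - 1) x (k - 1) - xs|^2]
   is nonincreasing: apply the proximal gradient inequality at the point
   [t^-1 xs + (1 - t^-1) x k]. The terms in the squared slope of the envelope
   that come from changing [mu] are nonpositive by the condition on [mu]. The
   envelope is within [mu N * Lg^2 / 2] of [g].
   The conjugate of [g] is never studied for itself: by Moreau's decomposition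
   the prox of the scaled conjugate is the slope [(v - prox_{mu g} v) / mu].
   To avoid computing with envelopes, [E k] is taken with the upper bound
   [g w + |w - K (x k)|^2 / (2 mu k)], where [w] is the proximal point computed
   at [K (y (k - 1))]. *)
Require Import Defs.
From mathcomp Require Import all_boot all_order all_algebra.
From mathcomp Require Import all_classical all_reals ereal topology normedtype.
From mathcomp Require Import interval_inference convex.
From mathcomp Require Import ring lra.
Set Implicit Arguments.
Unset Strict Implicit.
Unset Printing Implicit Defensive.
Import Order.TTheory GRing.Theory Num.Theory.
Import numFieldNormedType.Exports.
Local Open Scope classical_set_scope.
Local Open Scope ring_scope.

(** * Inner product calculus in a real Hilbert space *)

Section InnerProduct.
Context {R : realType} {H : hilbertType R}.
Implicit Types (u v w a : H) (t : R).

Lemma innerC u v : inner u v = inner v u.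
Proof. by rewrite hermC /= expr0 mul1r. Qed.

Lemma innerDl u v w : inner (u + v) w = inner u w + inner v w.
Proof. by rewrite linearDl. Qed.

Lemma innerDr u v w : inner w (u + v) = inner w u + inner w v.
Proof. by rewrite linearDr. Qed.

Lemma innerNl u w : inner (- u) w = - inner u w.
Proof. by rewrite linearNl. Qed.

Lemma innerNr u w : inner w (- u) = - inner w u.
Proof. by rewrite linearNr. Qed.

Lemma innerZl t u w : inner (t *: u) w = t * inner u w.
Proof. by rewrite linearZl_LR. Qed.

Lemma innerZr t u w : inner w (t *: u) = t * inner w u.
Proof. by rewrite linearZr_LR. Qed.

Definition innerE :=
  (innerDl, innerDr, innerNl, innerNr, innerZl, innerZr).

Lemma sqr_normD u v :
  `|u + v| ^+ 2 = `|u| ^+ 2 + 2 * inner u v + `|v| ^+ 2.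
Proof. by rewrite -!inner_norm !innerE (innerC v u); ring. Qed.

Lemma sqr_normB u v :
  `|u - v| ^+ 2 = `|u| ^+ 2 - 2 * inner u v + `|v| ^+ 2.
Proof. by rewrite sqr_normD innerNr normrN; ring. Qed.

(** The last term is the strong convexity of the squared distance: it forces near-minimizers to be
    close to each other and produces the extra square in the three-point inequality. *)
Lemma sqr_norm_conv t u v a :
  `|t *: u + (1 - t) *: v - a| ^+ 2 =
  t * `|u - a| ^+ 2 + (1 - t) * `|v - a| ^+ 2 - t * (1 - t) * `|u - v| ^+ 2.
Proof.
rewrite -!inner_norm !innerE (innerC v u) (innerC a u) (innerC a v).
ring.
Qed.

End InnerProduct.

(** * Existence of proximal points and the three-point inequality *)

Section ProximalPoint.
Context {R : realType} {H : hilbertType R}.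
Implicit Types (h : H -> \bar R) (u v a p : H).

Lemma convex_efun_fin h u v (t r s : R) : convex_efun h ->
  (forall w, -oo < h w)%E -> 0 <= t <= 1 -> h u = r%:E -> h v = s%:E ->
  exists2 q : R, h (t *: u + (1 - t) *: v) = q%:E & q <= t * r + (1 - t) * s.
Proof.
move=> hc hNy t01 hu hv.
have := hc t u v t01; rewrite hu hv -!EFinM -EFinD.
case: (h _) (hNy (t *: u + (1 - t) *: v)) => [q| |]//= _.
by rewrite lee_fin => ?; exists q.
Qed.

Lemma proper_fin h : proper_fun h -> exists u r, h u = r%:E.
Proof.
move=> [hNy [u huy]]; exists u.
by case: (h u) (hNy u) huy => [r| |]// _ _; exists r.
Qed.

(** Lower semicontinuity keeps [h] above [r0 - 1] on a ball of radius [e] around [x0]. Convexity on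
    the segment from [x0] to [u] then limits the decrease of [h] to slope [2 / e], and the square
    dominates this linear loss. *)
Lemma quadratic_lower_bound h a :
  proper_fun h -> convex_efun h -> lower_semicontinuous h ->
  exists M : R, forall u, (M%:E <= h u + (2^-1 * `|u - a| ^+ 2)%:E)%E.
Proof.
move=> hp hc hl; have [x0 [r0 hx0]] := proper_fin hp.
have hNy := hp.1.
have [] := hl x0 (r0 - 1); first by rewrite hx0 lte_fin; lra.
move=> V /nbhs_normP[e /= e0 eV] Vh.
set k := 2 / e; set D := `|a - x0|.
have k0 : 0 < k by rewrite divr_gt0.
exists (r0 - 1 - k * D - k ^+ 2 / 2) => u.
case hu: (h u) (hNy u) => [b| |]// _; last by rewrite addye// leey.
rewrite -EFinD lee_fin.
have tri : `|u - x0| <= `|u - a| + D.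
  by rewrite -[u - x0](subrKA a) ler_normD.
suff bE : r0 - 1 - k * `|u - x0| <= b.
  have ktri : k * `|u - x0| <= k * `|u - a| + k * D.
    by rewrite -mulrDr ler_pM2l.
  have : 0 <= (`|u - a| - k) ^+ 2 by rewrite sqr_ge0.
  nra.
have nge0 : 0 <= k * `|u - x0| by rewrite mulr_ge0// ltW.
have [lte|gee] := ltP `|x0 - u| e.
  by have := Vh u (eV u lte); rewrite hu lte_fin; lra.
have d0 : 0 < `|u - x0| by rewrite distrC; exact: lt_le_trans e0 gee.
(* This weight puts the point of the segment at distance [e / 2] from [x0], inside the ball, and
   makes [s * k * |u - x0|] equal to 1, the drop allowed there. *)
set s := e / (2 * `|u - x0|).
have s0 : 0 < s by rewrite divr_gt0// mulr_gt0.
have s1 : s <= 1.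
  by rewrite ler_pdivrMr ?mulr_gt0// mul1r; rewrite distrC in gee; lra.
have ks : s * (k * `|u - x0|) = 1.
  by rewrite /s /k; field; rewrite !gt_eqF.
have [|q hq qle] := convex_efun_fin (t := s) hc hNy _ hu hx0.
  by rewrite s1 ltW.
have : r0 - 1 < q.
  rewrite -lte_fin -hq; apply/Vh/eV; rewrite /=.
  have -> : x0 - (s *: u + (1 - s) *: x0) = s *: (x0 - u).
    by apply/eqP; rewrite subr_eq scalerBl scale1r scalerBr addrA subrK addrC subrK.
  rewrite normrZ gtr0_norm// distrC /s.
  have -> : e / (2 * `|u - x0|) * `|u - x0| = e / 2.
    by field; rewrite gt_eqF.
  lra.
move=> qgt.
have : s * (r0 - k * `|u - x0|) < s * b.
  have -> : s * (r0 - k * `|u - x0|) = s * r0 - s * (k * `|u - x0|) by ring.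
  rewrite ks; lra.
rewrite ltr_pM2l//; lra.
Qed.

Lemma lower_semicontinuousD (T : topologicalType) (h : T -> \bar R)
    (phi : T -> R) :
  lower_semicontinuous h -> continuous phi -> (forall w : T, -oo < h w)%E ->
  lower_semicontinuous (fun w : T => h w + (phi w)%:E)%E.
Proof.
move=> hl phic hNy z b bz.
have [r rh br] : exists2 r, (r%:E < h z)%E & b < r + phi z.
  case: (h z) (hNy z) bz => [q| |]// _.
    rewrite -EFinD lte_fin => bq.
    exists (q - (q + phi z - b) / 2); rewrite ?lte_fin; lra.
  by move=> _; exists (b - phi z + 1); rewrite ?ltry//; lra.
have [V Vz Vh] := hl z r rh.
have W : nbhs z [set w : T | b - r < phi w].
  by apply: (cvgr_gt (phi z) (phic z)); lra.
exists (V `&` [set w : T | b - r < phi w]); first exact: filterI.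
move=> w [/Vh hw /= phw]; apply: (@lt_le_trans _ _ (r%:E + (phi w)%:E)%E).
  by rewrite -EFinD lte_fin; lra.
by apply: leeD => //; exact: ltW.
Qed.

Lemma continuous_sqr_dist a : continuous (fun u : H => 2^-1 * `|u - a| ^+ 2 : R).
Proof.
move=> u; apply: cvgM; first exact: cvg_cst.
by rewrite expr2; apply: cvgM; apply: cvg_norm; apply: cvgB => //; exact: cvg_cst.
Qed.

(* The sublevel sets of the strongly convex function [h + |. - a|^2 / 2] just
   above its infimum have small diameter, so they form a Cauchy filter. *)
Lemma exists_minimizer h a :
  proper_fun h -> convex_efun h -> lower_semicontinuous h ->
  exists p, is_minimizer (fun u => h u + (2^-1 * `|u - a| ^+ 2)%:E)%E p.
Proof.
move=> hp hc hl; have hNy := hp.1.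
pose Q u := (h u + (2^-1 * `|u - a| ^+ 2)%:E)%E; rewrite -/Q.
have [M MQ] := quadratic_lower_bound a hp hc hl.
have [x0 [r0 hx0]] := proper_fin hp.
pose S := [set r : R | exists u, Q u = r%:E].
have S0 : S !=set0.
  by exists (r0 + 2^-1 * `|x0 - a| ^+ 2), x0; rewrite /Q hx0.
have SM : has_lbound S.
  by exists M => r [u ur]; rewrite -lee_fin -ur; exact: MQ.
pose m := inf S.
have Qfin u : exists r, Q u = r%:E \/ Q u = +oo%E.
  rewrite /Q; case: (h u) (hNy u) => [b| |]// _.
    by exists (b + 2^-1 * `|u - a| ^+ 2); left.
  by exists 0; right; rewrite addye.
have mQ u : (m%:E <= Q u)%E.
  have [r [ur|->]] := Qfin u; last by rewrite leey.
  by rewrite ur lee_fin; apply: ge_inf => //; exists u.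
pose B (e : R) := [set u | Q u <= (m + e)%:E]%E.
have B0 e : 0 < e -> B e !=set0.
  move=> e0; have [r [u ur] rm] := inf_adherent e0 (conj S0 SM).
  by exists u; rewrite /B /= ur lee_fin ltW.
pose F := filter_from [set e : R | 0 < e] B.
have FF : Filter F.
  apply: filter_from_filter; first by exists 1; rewrite /= ltr01.
  move=> i j /= i0 j0; exists (Num.min i j); first by rewrite /= lt_min i0.
  move=> u /= uij; split; apply: (le_trans uij);
    by rewrite lee_fin lerD2l ge_min lexx ?orbT.
have PF : ProperFilter F by apply: filter_from_proper => e /= /B0.
have Bdiam e u v : B e u -> B e v -> `|u - v| ^+ 2 <= 8 * e.
  rewrite /B /= /Q => ue ve.
  case hu: (h u) (hNy u) ue => [b| |]// _.
  case hv: (h v) (hNy v) ve => [c| |]// _.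
  rewrite -!EFinD !lee_fin => ve ue.
  (* At the midpoint [Q] is at least [m] and at most [m + e - |u - v|^2 / 8]. *)
  have [|q hq qle] := convex_efun_fin (t := 2^-1) hc hNy _ hu hv.
    by apply/andP; split; lra.
  have := mQ (2^-1 *: u + (1 - 2^-1) *: v).
  rewrite /Q hq -EFinD lee_fin sqr_norm_conv; lra.
have /cvg_ex[p Fp] : cvg F.
  apply: cauchy_cvg; apply/cauchyP => e /= e0.
  have d0 : 0 < e ^+ 2 / 16 by rewrite divr_gt0// exprn_gt0.
  have [u Bu] := B0 _ d0; exists u; exists (e ^+ 2 / 16) => //= v Bv.
  rewrite -ball_normE /=.
  rewrite -(@ltr_pXn2r _ 2) ?nnegrE ?normr_ge0 ?(ltW e0)//.
  apply: le_lt_trans (Bdiam _ _ _ Bu Bv) _.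
  have := exprn_gt0 2 e0; lra.
exists p => u; apply: le_trans (mQ u).
(* Otherwise lower semicontinuity keeps [Q] above some [b > m] near [p], whereas every neighbourhood
   of [p] contains points with [Q <= b]. *)
rewrite leNgt; apply/negP => mp.
have Ql : lower_semicontinuous Q.
  by apply: lower_semicontinuousD => //; exact: continuous_sqr_dist.
have [b mb bp] : exists2 b : R, m < b & (b%:E < Q p)%E.
  case: (Q p) mp => [q| |]//.
    by rewrite lte_fin => mq; exists ((m + q) / 2); rewrite ?lte_fin; lra.
  by move=> _; exists (m + 1); rewrite ?ltry//; lra.
have [V pV VQ] := Ql p b bp.
have [e /= e0 eV] := Fp V pV.
have me : 0 < Num.min e (b - m) by rewrite lt_min e0/=; lra.
have [w Bw] := B0 _ me.
have wV : V w.
  by apply: eV; apply: (le_trans Bw); rewrite lee_fin lerD2l ge_min lexx.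
have := VQ _ wV; rewrite ltNge => /negP; apply.
by apply: (le_trans Bw); rewrite lee_fin -lerBrDl ge_min lexx orbT.
Qed.

(** Comparing [p] with [t u + (1 - t) p] and dividing by [t] gives the inequality with the last
    square on the left multiplied by [1 - t]; then [t] tends to 0. *)
Lemma minimizer_three_point h a p r :
  (forall w, -oo < h w)%E -> convex_efun h -> h p = r%:E ->
  is_minimizer (fun u => h u + (2^-1 * `|u - a| ^+ 2)%:E)%E p ->
  forall u s, h u = s%:E ->
  r + 2^-1 * `|p - a| ^+ 2 + 2^-1 * `|u - p| ^+ 2 <= s + 2^-1 * `|u - a| ^+ 2.
Proof.
move=> hNy hc hp pmin u s hu.
set A := r + _; set B := 2^-1 * `|u - p| ^+ 2; set C := s + _.
have B0 : 0 <= B by rewrite mulr_ge0 ?sqr_ge0// invr_ge0.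
have key t : 0 < t <= 1 -> A + (1 - t) * B <= C.
  move=> /andP[t0 t1].
  have [|q hq qle] := convex_efun_fin (t := t) hc hNy _ hu hp.
    by rewrite ltW.
  have := pmin (t *: u + (1 - t) *: p).
  rewrite hp hq -!EFinD lee_fin sqr_norm_conv => le1.
  suff : t * (A + (1 - t) * B) <= t * C by rewrite ler_pM2l.
  rewrite /A /B /C; lra.
apply/ler_addgt0Pr => e e0.
have eB : 0 < e + B by rewrite ltr_wpDr.
(* For this [t] the loss [t * B] is at most [e]. *)
have := key (e / (e + B)).
rewrite divr_gt0//= ler_pdivrMr// mul1r lerDl => /(_ B0).
have : e / (e + B) * B <= e.
  by rewrite mulrAC ler_pdivrMr// ler_pM2l// lerDr ltW.
lra.
Qed.

Lemma ltNy_mule (c : R) (z : \bar R) : 0 <= c -> (-oo < z)%E -> (-oo < c%:E * z)%E.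
Proof.
rewrite le_eqVlt => /predU1P[<- _|c0]; first by rewrite mul0e ltNyr.
by case: z => [z| |]// _; rewrite -?EFinM ?ltNyr// gt0_muley.
Qed.

Lemma proper_funZ h (c : R) : 0 < c -> proper_fun h ->
  proper_fun (fun u => c%:E * h u)%E.
Proof.
move=> c0 hp; split=> [u|]; first exact: ltNy_mule (ltW c0) (hp.1 u).
by have [u [r hu]] := proper_fin hp; exists u; rewrite hu -EFinM ltry.
Qed.

Lemma convex_efunZ h (c : R) : 0 < c -> (forall u, -oo < h u)%E ->
  convex_efun h -> convex_efun (fun u => c%:E * h u)%E.
Proof.
move=> c0 hNy hc t u v t01; have /andP[t0 t1] := t01.
rewrite (muleCA t%:E) (muleCA (1 - t)%:E) -muleDr//; last first.
  by apply: ltninfty_adde_def; rewrite inE ltNy_mule// subr_ge0.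
by rewrite lee_pmul2l// hc.
Qed.

Lemma lower_semicontinuousZ h (c : R) : 0 < c ->
  lower_semicontinuous h -> lower_semicontinuous (fun u => c%:E * h u)%E.
Proof.
move=> c0 hl u b; rewrite -lte_pdivrMl// -EFinM => /hl[V uV Vh].
by exists V => // w /Vh; rewrite EFinM lte_pdivrMl.
Qed.

Lemma proxP h a :
  proper_fun h -> convex_efun h -> lower_semicontinuous h ->
  is_minimizer (fun u => h u + (2^-1 * `|u - a| ^+ 2)%:E)%E (prox h a).
Proof.
move=> hp hc hl; have [p pmin] := exists_minimizer a hp hc hl.
by rewrite /prox; case: xgetP => [q -> //|/(_ p)]; case.
Qed.

Lemma prox_three_point h (c : R) a : 0 < c ->
  proper_fun h -> convex_efun h -> lower_semicontinuous h ->
  let p := prox (fun u => c%:E * h u)%E a in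
  exists2 r, h p = r%:E & forall u s, h u = s%:E ->
    c * r + 2^-1 * `|p - a| ^+ 2 + 2^-1 * `|u - p| ^+ 2 <=
    c * s + 2^-1 * `|u - a| ^+ 2.
Proof.
move=> c0 hp hc hl p.
have chp := proper_funZ c0 hp.
have chc := convex_efunZ c0 hp.1 hc.
have pmin := proxP a chp chc (lower_semicontinuousZ c0 hl).
have [u0 [s0 hu0]] := proper_fin hp.
have [r hr] : exists r, h p = r%:E.
  have := pmin u0; rewrite hu0 -EFinM -EFinD -/p.
  by case: (h p) (hp.1 p) => [r| |]// _; [exists r|rewrite gt0_muley].
exists r => // u s hu.
by apply: (minimizer_three_point chp.1 chc _ pmin); rewrite ?hu -?/p ?hr.
Qed.

End ProximalPoint.

(** * Real-valued convex functions seen as extended-real ones *)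

Section RealValued.
Context {R : realType} {H : hilbertType R}.
Implicit Types (phi : H -> R) (u v : H).

Lemma proper_fun_EFin phi : proper_fun (fun u => (phi u)%:E).
Proof. by split=> [u|]; [rewrite ltNyr|exists 0; rewrite ltry]. Qed.

Lemma lower_semicontinuous_EFin phi :
  continuous phi -> lower_semicontinuous (fun u => (phi u)%:E).
Proof.
move=> phic u b; rewrite lte_fin => bu.
by exists [set w | b < phi w] => //; exact: cvgr_gt (phic u) _ bu.
Qed.

Lemma convex_efun_EFin phi :
  convex_function [set: convex_lmodType H] (phi : H -> R^o) ->
  convex_efun (fun u => (phi u)%:E).
Proof.
move=> phic t u v /andP[t0 t1]; rewrite -!EFinM -EFinD lee_fin.
exact: (phic (Itv01 t0 t1) u v (in_setT _) (in_setT _)).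
Qed.

End RealValued.

(** * Operator norm and adjoint *)

Section Operator.
Context {R : realType} {H G : hilbertType R} (K : {linear H -> G}).
Hypothesis K_continuous : continuous K.

Lemma operator_normP u : `|K u| <= operator_norm K * `|u|.
Proof.
have [M [Mr KM]] : \forall r \near +oo, forall x, `|K x| <= r * `|x|.
  by apply/linear_boundedP/linear_bounded_continuous.
have hs : has_sup [set `|K u| | u in [set u : H | `|u| <= 1]].
  split; first by exists `|K 0|, 0 => //=; rewrite normr0.
  exists (`|M| + 1) => _ [w /= w1 <-].
  apply: (le_trans (KM (`|M| + 1) _ w)).
    by rewrite (le_lt_trans (ler_norm _))// ltrDl.
  by rewrite ler_piMr// addr_ge0.
have [->|u0] := eqVneq u 0; first by rewrite linear0 !normr0 mulr0.
have nu : 0 < `|u| by rewrite normr_gt0.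
rewrite -ler_pdivrMr//.
apply: sup_upper_bound => //; exists (`|u|^-1 *: u) => /=.
  by rewrite normrZ gtr0_norm ?invr_gt0// mulVf ?gt_eqF.
by rewrite linearZ normrZ gtr0_norm ?invr_gt0// mulrC.
Qed.

Lemma operator_norm_gt0 : (exists u, K u != 0) -> 0 < operator_norm K.
Proof.
move=> [u Ku]; rewrite ltNge; apply/negP => K0.
have := operator_normP u; apply/negP; rewrite -ltNge.
by rewrite (@le_lt_trans _ _ 0) ?normr_gt0// mulr_le0_ge0.
Qed.

(* Riesz representation: [adjoint K v] minimizes [u |-> |u|^2 / 2 - <K u, v>]. *)
Lemma adjointP v u : inner (K u) v = inner u (adjoint K v).
Proof.
suff [z zP] : exists z, forall u, inner (K u) v = inner u z.
  by rewrite /adjoint; case: xgetP => [z' -> //|/(_ z)]; case.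
pose phi u := - inner (K u) v.
have phic : continuous phi.
  (* Polarization reduces the continuity of [phi] to that of the norm and of [K]. *)
  have -> : phi = fun u => 2^-1 * (`|K u| ^+ 2 + `|v| ^+ 2 - `|K u + v| ^+ 2).
    by apply/funext => w; rewrite /phi sqr_normD; field.
  move=> w; apply: cvgM; first exact: cvg_cst.
  apply: cvgB; first apply: cvgD; rewrite !expr2.
  - by apply: cvgM; apply: cvg_norm; exact: K_continuous.
  - exact: cvg_cst.
  - by apply: cvgM; apply: cvg_norm; apply: cvgD;
      [exact: K_continuous|exact: cvg_cst|exact: K_continuous|exact: cvg_cst].
have phi_convex : convex_efun (fun u => (phi u)%:E).
  move=> t a b _; rewrite -!EFinM -EFinD lee_fin /phi.
  by rewrite linearD !linearZ !innerE; lra.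
have [r [<-] zmin] := prox_three_point 0 (@ltr01 R) (proper_fun_EFin phi)
  phi_convex (lower_semicontinuous_EFin phic).
set z := prox _ _ in zmin.
(* The squares of [d] cancel in the three-point inequality at [z + d]. What remains is linear in
   [d], so using it for [w] and [- w] gives equality. *)
have half d : inner (K d) v <= inner d z.
  have := zmin (z + d) _ erefl.
  rewrite /phi !subr0 (addrC z d) addrK sqr_normD linearD innerDl.
  lra.
exists z => w; apply/le_anti/andP; split; first exact: half.
by have := half (- w); rewrite linearN !innerNl lerN2.
Qed.

End Operator.

(** * Moreau envelope and Moreau decomposition *)

Section Smoothing.
Context {R : realType} {G : hilbertType R} (g : G -> R).
Hypothesis g_convex : convex_function [set: convex_lmodType G] (g : G -> R^o).
Hypothesis g_continuous : continuous g.
Implicit Types (v w q : G) (m : R).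

(* [smooth_slope m v] is the gradient at [v] of the Moreau envelope of [g] with
   parameter [m], and [smooth_point m v] is where that envelope is attained. *)
Definition smooth_point m v := prox (fun w => (m%:E * (g w)%:E)%E) v.

Definition smooth_slope m v := m^-1 *: (v - smooth_point m v).

Lemma smooth_slopeE m v : 0 < m ->
  v - smooth_point m v = m *: smooth_slope m v.
Proof. by move=> m0; rewrite scalerA divff ?gt_eqF// scale1r. Qed.

(** The squares in the three-point inequality cancel once [w - v] is expanded around the proximal
    point, and only the linear term is left. *)
Lemma smooth_slope_subgradient m v w : 0 < m ->
  g (smooth_point m v) + inner (smooth_slope m v) (w - smooth_point m v) <= g w.
Proof.
move=> m0.
have [r [<-] /(_ w _ erefl)] := prox_three_point v m0 (proper_fun_EFin g)
  (convex_efun_EFin g_convex) (lower_semicontinuous_EFin g_continuous).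
rewrite -/(smooth_point m v); set z := smooth_point m v => le1.
rewrite -(ler_pM2l m0) mulrDr.
have -> : m * inner (smooth_slope m v) (w - z) = inner (v - z) (w - z).
  by rewrite smooth_slopeE// innerZl.
have e : `|w - v| ^+ 2 = `|w - z| ^+ 2 - 2 * inner (v - z) (w - z) + `|z - v| ^+ 2.
  rewrite -[w - v](subrKA z) (sqr_normD (w - z)) -(opprB v z) innerNr normrN.
  rewrite (innerC (w - z)).
  ring.
rewrite e in le1; lra.
Qed.

(** The subgradient inequality gives equality in Fenchel-Young for the slope [p] and the proximal
    point [z]. At any other [q], Fenchel-Young with the same [z] bounds the conjugate below, so the
    prox objective grows quadratically away from [p], its only minimizer. *)
Lemma prox_conjugate m v : 0 < m ->
  prox (fun q => ((1 / m)%:E *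
    fenchel_conjugate (fun w => (g w)%:E) q)%E) (m^-1 *: v) =
  smooth_slope m v.
Proof.
move=> m0; rewrite div1r.
have sub w := smooth_slope_subgradient v w m0.
have vE := smooth_slopeE v m0.
move: (smooth_slope m v) (smooth_point m v) sub vE => p z sub vE.
set gs := fenchel_conjugate _.
have gs_ge q : ((inner z q - g z)%:E <= gs q)%E.
  by apply: ereal_sup_ubound; exists z.
have gs_p : gs p = (inner z p - g z)%:E.
  apply/le_anti; rewrite gs_ge andbT.
  apply: ge_ereal_sup => _ [w _ <-]; rewrite -EFinB lee_fin.
  by have := sub w; rewrite innerDr innerNr (innerC p w) (innerC p z); lra.
set Q := fun q => ((m^-1)%:E * gs q + (2^-1 * `|q - m^-1 *: v| ^+ 2)%:E)%E.
have m0' : 0 < m^-1 by rewrite invr_gt0.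
have growth q : (Q p + (2^-1 * `|q - p| ^+ 2)%:E <= Q q)%E.
  rewrite /Q gs_p -EFinM -!EFinD.
  case: (gs q) (gs_ge q) => [b| |]//; last first.
    by move=> _; rewrite gt0_muley ?lte_fin// addye//; exact: leey.
  rewrite -EFinM -EFinD !lee_fin => gzb.
  have -> : m^-1 *: v = p + m^-1 *: z.
    by rewrite -[v in LHS](subrK z) vE scalerDr scalerA mulVf ?gt_eqF// scale1r.
  rewrite !opprD !addrA subrr add0r (sqr_normB (q - p)) normrN innerZr innerDl innerNl.
  have : m^-1 * (inner z q - g z) <= m^-1 * b by rewrite ler_pM2l.
  rewrite (innerC q) (innerC p); lra.
have Qp : Q p \is a fin_num by rewrite /Q gs_p -EFinM -EFinD.
rewrite /prox; case: xgetP => [q qE qmin|/(_ p)]; last first.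
  case=> q; apply: le_trans (growth q).
  by rewrite leeDl// lee_fin mulr_ge0 ?sqr_ge0.
have := le_trans (growth q) (qmin p).
rewrite -[leRHS]adde0 leeD2lE// lee_fin => le0.
have : `|q - p| ^+ 2 == 0 by rewrite eq_le sqr_ge0 andbT; lra.
by rewrite sqrf_eq0 normr_eq0 subr_eq0 => /eqP.
Qed.

End Smoothing.

(** * Descent estimate for a single iteration *)

Section VastStep.
Context {R : realType} {H G : hilbertType R}.
Context (f : H -> \bar R) (g : G -> R) (K : {linear H -> G}).
Hypothesis f_proper : proper_fun f.
Hypothesis f_convex : convex_efun f.
Hypothesis f_lsc : lower_semicontinuous f.
Hypothesis g_convex : convex_function [set: convex_lmodType G] (g : G -> R^o).
Hypothesis g_continuous : continuous g.
Hypothesis K_continuous : continuous K.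
Hypothesis K_neq0 : exists u, K u != 0.

(* [g w + <p, K z - w> - m / 2 |p|^2] is the linearization at [y] of the Moreau
   envelope of [g] composed with [K], evaluated at [z]. *)
Lemma vast_step_bound (m : R) (y : H) : 0 < m ->
  let gamma := 1 / (operator_norm K ^+ 2 / m) in
  let w := smooth_point g m (K y) in
  let p := smooth_slope g m (K y) in
  let x := prox (fun u => gamma%:E * f u)%E (y - gamma *: adjoint K p) in
  exists2 r, f x = r%:E & forall z s, f z = s%:E ->
    gamma * (r + (g w + `|w - K x| ^+ 2 / (2 * m))) + 2^-1 * `|z - x| ^+ 2 <=
    gamma * (s + (g w + inner p (K z - w) - m / 2 * `|p| ^+ 2))
      + 2^-1 * `|z - y| ^+ 2.
Proof.
move=> m0 gamma w p x.
have N0 := operator_norm_gt0 K_continuous K_neq0.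
have gamma0 : 0 < gamma by rewrite /gamma !divr_gt0// exprn_gt0.
have [r fx three] := prox_three_point (y - gamma *: adjoint K p) gamma0
  f_proper f_convex f_lsc.
rewrite -/x in fx three; exists r => // z s fz.
have := three z s fz.
have expand u : `|u - (y - gamma *: adjoint K p)| ^+ 2 = `|u - y| ^+ 2 +
    2 * gamma * inner p (K u - K y) + gamma ^+ 2 * `|adjoint K p| ^+ 2.
  rewrite opprB addrCA addrC sqr_normD innerZr normrZ exprMn.
  rewrite real_normK ?num_real// -adjointP// linearB innerC; ring.
rewrite !expand.
have wE : K y - w = m *: p by exact: smooth_slopeE.
have -> : `|w - K x| ^+ 2 = `|K (x - y)| ^+ 2 + 2 * m * inner p (K x - K y)
    + m ^+ 2 * `|p| ^+ 2.
  rewrite distrC -(subrKA (K y)) wE sqr_normD innerZr normrZ exprMn.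
  by rewrite real_normK ?num_real// linearB innerC; ring.
have -> : inner p (K z - w) = inner p (K z - K y) + m * `|p| ^+ 2.
  by rewrite -(subrKA (K y)) wE innerDr innerZr inner_norm.
(* The step size enters here: [gamma] times the squared norm of [K] equals [m], so the proximal
   square pays for the curvature of the envelope. *)
have KN : gamma * `|K (x - y)| ^+ 2 / (2 * m) <= 2^-1 * `|x - y| ^+ 2.
  have -> : gamma * `|K (x - y)| ^+ 2 / (2 * m) =
      2^-1 * (`|K (x - y)| ^+ 2 / operator_norm K ^+ 2).
    by rewrite /gamma; field; rewrite !gt_eqF.
  rewrite ler_pM2l ?invr_gt0// ler_pdivrMr ?exprn_gt0// -exprMn.
  rewrite lerXn2r ?nnegrE ?mulr_ge0 ?(ltW N0)// mulrC.
  exact: operator_normP.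
have -> : gamma * (r + (g w + (`|K (x - y)| ^+ 2 + 2 * m * inner p (K x - K y) +
    m ^+ 2 * `|p| ^+ 2) / (2 * m))) = gamma * r + gamma * g w +
    gamma * `|K (x - y)| ^+ 2 / (2 * m) + gamma * inner p (K x - K y) +
    gamma * (m / 2 * `|p| ^+ 2).
  by field; rewrite gt_eqF.
lra.
Qed.

(* One iteration, tested at the point [t^-1 xs + (1 - t^-1) x0]. The last
   hypothesis on [m] absorbs the change of smoothing parameter. *)
Lemma vast_step_descent (m m0 t : R) (y x0 xs : H) (w0 : G) (r0 rs : R) :
  0 < m -> 0 < m0 -> 1 <= t -> (1 - t^-1) * m0 <= m ->
  f x0 = r0%:E -> f xs = rs%:E ->
  let gamma := 1 / (operator_norm K ^+ 2 / m) in
  let w := smooth_point g m (K y) in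
  let x := prox (fun u => gamma%:E * f u)%E
             (y - gamma *: adjoint K (smooth_slope g m (K y))) in
  exists2 r, f x = r%:E &
    2 * gamma * t ^+ 2 *
      (r + (g w + `|w - K x| ^+ 2 / (2 * m)) - (rs + g (K xs)))
    + `|t *: x - (t - 1) *: x0 - xs| ^+ 2 <=
    2 * (gamma * t * (t - 1)) *
      (r0 + (g w0 + `|w0 - K x0| ^+ 2 / (2 * m0)) - (rs + g (K xs)))
    + `|t *: y - (t - 1) *: x0 - xs| ^+ 2.
Proof.
move=> m_gt0 m0_gt0 t1 mm0 fx0 fxs gamma w x.
have t0 : 0 < t := lt_le_trans ltr01 t1.
have ti : 0 < t^-1 <= 1 by rewrite invr_gt0 t0 invf_le1.
have /andP[ti0 ti1] := ti.
have N0 := operator_norm_gt0 K_continuous K_neq0.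
have gamma0 : 0 < gamma by rewrite /gamma !divr_gt0// exprn_gt0.
have [r fx bound] := vast_step_bound y m_gt0.
rewrite -/gamma -/w -/x in fx bound.
exists r => //.
have [|s fz sle] := convex_efun_fin (t := t^-1) f_convex f_proper.1 _ fxs fx0.
  by rewrite ltW.
have := bound _ _ fz.
set p := smooth_slope g m (K y).
set E := r + _; set E0 := r0 + _; set z := t^-1 *: xs + _.
(* Since [t z = xs + (t - 1) x0], both squares of the conclusion are scaled distances to [z]. *)
have tz u : `|t *: u - (t - 1) *: x0 - xs| ^+ 2 = t ^+ 2 * `|z - u| ^+ 2.
  rewrite /z -!inner_norm !innerE (innerC xs u) (innerC x0 u) (innerC xs x0).
  by field; rewrite gt_eqF.
rewrite !tz.
have sub v : g w + inner p (v - w) <= g v by exact: smooth_slope_subgradient.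
clearbody p.
have Kz : inner p (K z - w) = t^-1 * inner p (K xs - w) +
    (1 - t^-1) * (inner p (w0 - w) - inner p (w0 - K x0)).
  by rewrite /z (linearD K) !(linearZ_LR K) !innerE; ring.
(* Passing between [w0] and [K x0] costs [m0 / 2 * |p|^2]. After the factor [1 - t^-1], the term
   [- m / 2 * |p|^2] of the step bound covers this cost. *)
have young : - inner p (w0 - K x0) <=
    m0 / 2 * `|p| ^+ 2 + `|w0 - K x0| ^+ 2 / (2 * m0).
  have : 0 <= `|m0 *: p + (w0 - K x0)| ^+ 2 / (2 * m0).
    by rewrite divr_ge0 ?sqr_ge0// mulr_ge0// ltW.
  rewrite (sqr_normD (m0 *: p)) normrZ exprMn real_normK ?num_real// innerZl.
  set a := inner _ _; set b := `|p|; set c := `|_ - _|.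
  have -> : (m0 ^+ 2 * b ^+ 2 + 2 * (m0 * a) + c ^+ 2) / (2 * m0) =
    m0 / 2 * b ^+ 2 + a + c ^+ 2 / (2 * m0) by field; rewrite gt_eqF.
  lra.
have lin : s + (g w + inner p (K z - w) - m / 2 * `|p| ^+ 2) <=
    t^-1 * (rs + g (K xs)) + (1 - t^-1) * E0.
  have s1 := sub (K xs); have s2 := sub w0.
  have h1 : t^-1 * (g w + inner p (K xs - w)) <= t^-1 * g (K xs).
    by rewrite ler_pM2l.
  have h2 : (1 - t^-1) * (g w + inner p (w0 - w) - inner p (w0 - K x0)) <=
      (1 - t^-1) *
      (g w0 + (m0 / 2 * `|p| ^+ 2 + `|w0 - K x0| ^+ 2 / (2 * m0))).
    by rewrite ler_wpM2l ?subr_ge0//; lra.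
  have h3 : (1 - t^-1) * m0 * (`|p| ^+ 2 / 2) <= m * (`|p| ^+ 2 / 2).
    by rewrite ler_wpM2r// divr_ge0 ?sqr_ge0.
  rewrite Kz /E0; lra.
move=> le1.
have le2 : gamma * E + 2^-1 * `|z - x| ^+ 2 <=
    gamma * (t^-1 * (rs + g (K xs)) + (1 - t^-1) * E0) + 2^-1 * `|z - y| ^+ 2.
  by apply: le_trans le1 _; rewrite lerD2r ler_pM2l.
have t20 : 0 < 2 * t ^+ 2 by rewrite mulr_gt0// exprn_gt0.
move: le2; rewrite -(ler_pM2l t20).
have -> : 2 * t ^+ 2 * (gamma * (t^-1 * (rs + g (K xs)) + (1 - t^-1) * E0) +
    2^-1 * `|z - y| ^+ 2) = 2 * gamma * (t * (rs + g (K xs)) +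
    t * (t - 1) * E0) + t ^+ 2 * `|z - y| ^+ 2.
  by field; rewrite gt_eqF.
lra.
Qed.

End VastStep.

(** * Induction over the iterations and the final bound *)

Theorem theorem3p1 (R : realType) (H G : hilbertType R)
  (f : H -> \bar R) (g : G -> R) (Lg : R) (K : {linear H -> G})
  (mu t : nat -> R) (x y : nat -> H)
  (f_proper : proper_fun f)
  (f_convex : convex_efun f)
  (f_lsc : lower_semicontinuous f)
  (g_convex : convex_function [set: convex_lmodType G] (g : G -> R^o))
  (Lg_gt0 : 0 < Lg)
  (g_lipschitz : Lg.-lipschitz (g : G -> R^o))
  (K_continuous : continuous K)
  (K_neq0 : exists u : H, K u != 0)
  (mu_gt0 : forall k : nat, (1 <= k)%N -> 0 < mu k)
  (t1 : t 1%N = 1)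
  (t_ge1 : forall k : nat, (2 <= k)%N -> 1 <= t k)
  (xy_vast : vast_sequences f g K mu t x y)
  (mu_cond : forall k : nat, (1 <= k)%N ->
     mu k - mu k.+1 - mu k.+1 / t k.+1 <= 0)
  (t_cond : forall k : nat, (1 <= k)%N ->
     (1 - 1 / t k.+1) * vast_gamma K mu k.+1 * t k.+1 ^+ 2
     = vast_gamma K mu k * t k ^+ 2)
  (xs : H) (xs_opt : is_minimizer (objective f g K) xs)
  (N : nat) (N_ge1 : (1 <= N)%N) :
  (objective f g K (x N) - objective f g K xs
   <= (`|x 0%N - xs| ^+ 2 / (2 * vast_gamma K mu N * t N ^+ 2)
       + mu N * (Lg ^+ 2 / 2))%:E)%E.
Proof.
have g_continuous : continuous g.
  move=> v; apply/cvgrPdist_lt => e e0; near=> w.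
  apply: le_lt_trans (g_lipschitz (v, w) (conj I I)) _ => /=.
  rewrite -ltr_pdivlMl//; near: w; apply: cvgr_dist_lt => //.
  by rewrite mulr_gt0// invr_gt0.
have [xy0 vast] := xy_vast.
have [rs fxs] : exists rs, f xs = rs%:E.
  have [u [r fu]] := proper_fin f_proper.
  have := xs_opt u; rewrite /objective fu -EFinD.
  by case: (f xs) (f_proper.1 xs) => [rs| |]// _ _; exists rs.
pose w k := smooth_point g (mu k) (K (y k.-1)).
pose E k r := r + (g (w k) + `|w k - K (x k)| ^+ 2 / (2 * mu k)).
pose F := rs + g (K xs).
have xE k : (1 <= k)%N -> x k =
    prox (fun u => ((vast_gamma K mu k)%:E * f u)%E) (y k.-1 -
      vast_gamma K mu k *: adjoint K (smooth_slope g (mu k) (K (y k.-1)))).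
  by move=> k1; rewrite -prox_conjugate ?mu_gt0//; case: (vast k k1).
(* The index starts at 1 because [f (x 0)] may be [+oo]. *)
have lyapunov k : exists2 r, f (x k.+1) = r%:E &
    2 * vast_gamma K mu k.+1 * t k.+1 ^+ 2 * (E k.+1 r - F)
    + `|t k.+1 *: x k.+1 - (t k.+1 - 1) *: x k - xs| ^+ 2 <= `|x 0%N - xs| ^+ 2.
  elim: k => [|k [r0 fx0 IH]].
    (* With [t = 1] the previous iterate has coefficient 0, so [xs], [0] and [mu 1] can stand in for
       its data. *)
    have [|r] := vast_step_descent f_proper f_convex f_lsc g_convex
      g_continuous K_continuous K_neq0 (y 0%N) 0 (mu_gt0 1%N isT)
      (mu_gt0 1%N isT) (lexx 1) _ fxs fxs.
      by rewrite invr1 subrr mul0r ltW// mu_gt0.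
    rewrite -/(w 1%N) -/(vast_gamma K mu 1) -xE// => fx1 le1.
    exists r => //; move: le1.
    by rewrite t1 !subrr !scale0r !mulr0 mul0r add0r !subr0 !scale1r xy0.
  have t0 : 0 < t k.+2 by apply: lt_le_trans ltr01 (t_ge1 _ _).
  have [|r] := vast_step_descent f_proper f_convex f_lsc g_convex
    g_continuous K_continuous K_neq0 (y k.+1) (w k.+1) (mu_gt0 k.+2 isT)
    (mu_gt0 k.+1 isT) (t_ge1 k.+2 isT) _ fx0 fxs.
    (* With [t = t k.+2], multiplying the condition on [mu] by [1 - 1/t] gives
       [(1 - 1/t) mu k.+1 <= (1 - 1/t^2) mu k.+2], which is at most [mu k.+2]. *)
    have tm : (t k.+2)^-1 <= 1 by rewrite invf_le1// t_ge1.
    have : (1 - (t k.+2)^-1) *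
        (mu k.+1 - mu k.+2 - mu k.+2 / t k.+2) <= 0.
      by rewrite mulr_ge0_le0 ?subr_ge0// mu_cond.
    have : 0 <= mu k.+2 * (t k.+2)^-1 ^+ 2.
      by rewrite mulr_ge0 ?sqr_ge0// ltW// mu_gt0.
    lra.
  rewrite -/(w k.+2) -/(vast_gamma K mu k.+2) -xE// => fx1 le1.
  exists r => //; apply: le_trans le1 _; apply: le_trans IH.
  have -> : vast_gamma K mu k.+2 * t k.+2 * (t k.+2 - 1) =
      vast_gamma K mu k.+1 * t k.+1 ^+ 2.
    by rewrite -t_cond//; field; rewrite gt_eqF.
  rewrite mulrA lerD2l le_eqVlt; apply/orP; left; apply/eqP.
  (* The extrapolation weight is such that [t k.+2 y k.+1 - (t k.+2 - 1) x k.+1] equals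
     [t k.+1 x k.+1 - (t k.+1 - 1) x k], so the two squares agree. *)
  have [_ ->] := vast k.+1 isT; rewrite /=.
  rewrite -!inner_norm !innerE (innerC xs (x k)) (innerC xs (x k.+1))
    (innerC (x k) (x k.+1)).
  by field; rewrite gt_eqF.
have [r fx lya] := lyapunov N.-1.
rewrite prednK// in fx lya.
have gamma0 : 0 < vast_gamma K mu N.
  rewrite /vast_gamma /vast_L !divr_gt0 ?mu_gt0//.
  exact/exprn_gt0/operator_norm_gt0.
have t0 : 0 < t N.
  by move: N_ge1; case: (N) => [|[|n]]// _; rewrite ?t1// (lt_le_trans ltr01)// t_ge1.
have den : 0 < 2 * vast_gamma K mu N * t N ^+ 2.
  by rewrite pmulr_rgt0 ?exprn_gt0// pmulr_rgt0.
have EF : E N r - F <= `|x 0%N - xs| ^+ 2 / (2 * vast_gamma K mu N * t N ^+ 2).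
  rewrite ler_pdivlMr// mulrC; apply: le_trans lya.
  by rewrite lerDl sqr_ge0.
rewrite /objective fx fxs -!EFinD lee_fin.
apply: (@le_trans _ _ (E N r - F + mu N * (Lg ^+ 2 / 2))); last by rewrite lerD2r.
rewrite /E /F; have muN := mu_gt0 N N_ge1.
have := g_lipschitz (K (x N), w N) (conj I I).
rewrite /= (distrC (K _)); set e := `|w N - K (x N)| => gL.
have := le_trans (ler_norm _) gL.
(* Completing the square bounds the gap [Lg * e - e^2 / (2 mu N)] between [g] and its smoothed
   value, uniformly in [e]. *)
have : 0 <= (e - mu N * Lg) ^+ 2 / (2 * mu N).
  by rewrite divr_ge0 ?sqr_ge0// mulr_ge0// ltW.
have -> : (e - mu N * Lg) ^+ 2 / (2 * mu N) =
    e ^+ 2 / (2 * mu N) - Lg * e + mu N * (Lg ^+ 2 / 2).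
  by field; rewrite gt_eqF.
lra.
Unshelve. all: by end_near. Qed.
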